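(* Let $a,b\in\mathbb{R}$ with $b>1$. Then $$\pi=\frac{2b^4\left((1+b^2)\,K\!\left(\dfrac{2b\sin a}{\sqrt{b^4-2b^2\cos2a+1}}\right)-\sqrt{b^4-2b^2\cos2a+1}\;K\!\left(\dfrac{2b\cos a}{1+b^2}\right)\right)}{(1+b^2)\sqrt{b^4-2b^2\cos2a+1}\;F_D^{(3)}\!\left(\tfrac32;\tfrac12,\tfrac12,\tfrac12;2\,\Big|\,\dfrac1{b^4},\dfrac{e^{-2ia}}{b^2},\dfrac{e^{2ia}}{b^2}\right)}.$$
   Context: $K(k)=\int_0^1\frac{dx}{\sqrt{(1-x^2)(1-k^2x^2)}}$ is the complete elliptic integral of the first kind, as a function of the modulus $k$. The Lauricella function of $n$ variables is $F_D^{(n)}(\alpha;\beta_1,\dots,\beta_n;\gamma\,|\,x_1,\dots,x_n)=\sum_{m_1,\dots,m_n\ge0}\frac{(\alpha)_{m_1+\cdots+m_n}(\beta_1)_{m_1}\cdots(\beta_n)_{m_n}}{(\gamma)_{m_1+\cdots+m_n}\,m_1!\cdots m_n!}x_1^{m_1}\cdots x_n^{m_n}$ for $|x_j|<1$, with $(x)_k$ the Pochhammer symbol. For $\operatorname{Re}\gamma>\operatorname{Re}\alpha>0$ it equals, and outside the region of convergence is defined by analytic continuation through, $\frac{\Gamma(\gamma)}{\Gamma(\alpha)\Gamma(\gamma-\alpha)}\int_0^1\frac{u^{\alpha-1}(1-u)^{\gamma-\alpha-1}}{(1-x_1u)^{\beta_1}\cdots(1-x_nu)^{\beta_n}}\,du$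 (principal branches, $x_j\notin[1,\infty)$). Here $i$ is the imaginary unit. *)

(* Defs.v *)
From mathcomp Require Import all_boot all_order all_algebra.
From mathcomp Require Import complex.
From mathcomp Require Import all_classical all_reals all_analysis.
From mathcomp Require summability.

Set Implicit Arguments.
Unset Strict Implicit.
Unset Printing Implicit Defensive.

Import Order.TTheory GRing.Theory Num.Theory.
Import numFieldNormedType.Exports.

Local Open Scope classical_set_scope.
Local Open Scope ring_scope.
Local Open Scope complex_scope.

(* For |k| < 1 the integrand is nonnegative, so the Lebesgue integral is the
   improper integral; the value of the integrand at x = 1 is irrelevant. *)
Definition ellipticK (R : realType) (k : R) : R :=
  \int[@lebesgue_measure R]_(x in `[0, 1])
    (Num.sqrt ((1 - x ^+ 2) * (1 - k ^+ 2 * x ^+ 2)))^-1.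

Definition pochhammer (C : pzRingType) (x : C) (k : nat) : C :=
  \prod_(0 <= i < k) (x + i%:R).

Definition cexp (R : realType) (z : R[i]) : R[i] :=
  (expR (complex.Re z))%:C * (cos (complex.Im z) +i* sin (complex.Im z)).

Definition lauricellaFD_term (R : realType) (n : nat)
    (alpha : R[i]) (beta : n.-tuple R[i]) (gamma : R[i]) (x : n.-tuple R[i])
    (m : {ffun 'I_n -> nat}) : R[i] :=
  let M := (\sum_(j < n) m j)%N in
  pochhammer alpha M * (\prod_(j < n) pochhammer (tnth beta j) (m j))
  / (pochhammer gamma M * (\prod_(j < n) (m j)`!%:R))
  * \prod_(j < n) tnth x j ^+ m j.

(* The sum over all multi-indices m is the limit of the sums over finite sets
   of multi-indices, directed by inclusion. It is the Lauricella function on the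
   domain |x_j| < 1 of absolute convergence; no analytic continuation outside
   that domain is included. *)
Definition lauricellaFD (R : realType) (n : nat)
    (alpha : R[i]) (beta : n.-tuple R[i]) (gamma : R[i])
    (x : n.-tuple R[i]) : R[i] :=
  summability.sum (lauricellaFD_term alpha beta gamma x : _ -> R[i]^o).

(* Main.v *)
Require Import Defs.
From mathcomp Require Import all_boot all_order all_algebra finmap.
From mathcomp Require Import complex ring lra.
From mathcomp Require Import all_classical all_reals all_analysis.
From mathcomp Require Import measurable_realfun.
From mathcomp Require summability.

Import Order.TTheory GRing.Theory Num.Theory.
Import numFieldNormedType.Exports.

Local Open Scope classical_set_scope.
Local Open Scope ring_scope.
Local Open Scope complex_scope.

(** The bracket with the two elliptic integrals and the Lauricella value are, up
    to explicit factors, the same integral over a quarter period.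

    The bracket.  Write Q s = b^4 - 2 b^2 cos(2a) s^2 + s^4.  With s = sin t
    and t running over [0, pi/2], the substitutions
      x = (1 + b^2) s / (b^2 + s^2)   and   x = sqrt (Q 1) s / sqrt (Q s)
    map [0, 1] increasingly onto itself and turn the two elliptic integrands
    into (b^2 - s^2) and (b^2 + s^2) over the common radical
    sqrt (b^4 - s^2) sqrt (Q s), up to the factors 1 + b^2 and sqrt (Q 1)
    ([ellipticK_cos], [ellipticK_sin]).  They come from splitting the genus 2
    curve behind the Lauricella integral by its involution v -> 1/v, where
    v = (s/b)^2: the coordinates sqrt v + 1/sqrt v and 1/sqrt v - sqrt v live on
    the two elliptic quotients.  In the bracket of the theorem the terms in b^2
    cancel, and what remains is a multiple of the integral of s^2 over the
    radical ([ellipticK_diff]).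

    The Lauricella value.  By Wallis' recurrence (3/2)_M / (2)_M is the M-th moment
    of the probability (4/pi) sin^2 t dt under u = sin^2 t ([beta_meanX]), so
    the Lauricella series is the mean of the product of the three binomial
    series (1 - x_j u)^(-1/2), provided sum and integral may be exchanged.  All
    |x_j| are at most r = b^-2 < 1, so the convergence is uniform in u and the
    exchange is elementary ([lauricella_half_beta_mean]).

    No complex square root is needed: the square of the truncated binomial
    series is close to 1/(1 - x) ([invsqrt_poly_sqr_approx]), and since two of
    the arguments are complex conjugate, their contribution is |p(z)|^2, hence
    close to 1/|1 - z| ([invsqrt_poly_prod_approx]).  The limit
    1 / (sqrt (1 - r^2 u) |1 - r e^(2ia) u|) is b^4 over the radical above.
    It is at least 1/2, so the Lauricella value does not vanish, and dividing
    by it gives the formula for pi. *)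

(** * Coefficients of the binomial series of exponent -1/2 *)

(** The coefficient of x^n in (1 - x)^(-1/2). *)
Definition invsqrt_coef (K : numFieldType) (n : nat) : K :=
  pochhammer (1 / 2) n / n`!%:R.

Lemma pochhammerS (C : pzRingType) (x : C) n :
  pochhammer x n.+1 = pochhammer x n * (x + n%:R).
Proof. by rewrite /pochhammer big_nat_recr. Qed.

Lemma pochhammer_gt0 (K : numFieldType) (x : K) n : 0 < x -> 0 < pochhammer x n.
Proof.
move=> x0; elim: n => [|n IH]; first by rewrite /pochhammer big_nil.
by rewrite pochhammerS mulr_gt0// ltr_wpDr.
Qed.

Lemma invsqrt_coef0 (K : numFieldType) : invsqrt_coef K 0 = 1.
Proof. by rewrite /invsqrt_coef /pochhammer big_nil fact0 divr1. Qed.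

Lemma invsqrt_coefS (K : numFieldType) n :
  n.+1%:R * invsqrt_coef K n.+1 = (n%:R + 1 / 2) * invsqrt_coef K n.
Proof.
rewrite /invsqrt_coef pochhammerS factS natrM.
have n0 : n.+1%:R != 0 :> K by rewrite pnatr_eq0.
have f0 : n`!%:R != 0 :> K by rewrite pnatr_eq0 -lt0n fact_gt0.
rewrite invfM -[n.+1%:R]natr1 in n0 *; by field; rewrite f0 n0.
Qed.

Lemma invsqrt_coef_ge0 (K : numFieldType) n : 0 <= invsqrt_coef K n.
Proof. by rewrite divr_ge0// ltW// pochhammer_gt0// divr_gt0. Qed.

Lemma invsqrt_coef_le1 (K : numFieldType) n : invsqrt_coef K n <= 1.
Proof.
elim: n => [|n IH]; first by rewrite invsqrt_coef0.
rewrite -(@ler_pM2l _ n.+1%:R)// invsqrt_coefS mulr1.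
apply: (@le_trans _ _ (n%:R + 1 / 2)).
  by rewrite ler_piMr// addr_ge0// divr_ge0.
by rewrite -[n.+1%:R]natr1 lerD2l ler_pdivrMr// mul1r ler1n.
Qed.

(** The square of the series of (1 - x)^(-1/2) is the geometric series.  Let e_n be
    the sum below.  By symmetry, weighting its terms by j gives n e_n / 2; the
    recurrence [invsqrt_coefS], applied to the weighted terms of e_(n + 1), then
    yields (n + 1) e_(n + 1) = (n + 1) e_n. *)
Lemma invsqrt_coef_conv (K : numFieldType) n :
  \sum_(j < n.+1) invsqrt_coef K j * invsqrt_coef K (n - j) = 1.
Proof.
set d := invsqrt_coef K.
elim: n => [|n IH]; first by rewrite big_ord1 subnn /d invsqrt_coef0 mulr1.
have sym m (F : nat -> K) :
    \sum_(j < m.+1) F j * (d j * d (m - j)%N)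
  = \sum_(j < m.+1) F (m - j)%N * (d j * d (m - j)%N).
  rewrite (reindex_inj rev_ord_inj) /=; apply: eq_bigr => j _.
  by rewrite subSS subKn -1?ltnS// [d (m - j)%N * _]mulrC.
(* Weighting the terms by j gives half of the sum weighted by j + (m - j). *)
have wsum m : 2 * \sum_(j < m.+1) j%:R * (d j * d (m - j)%N)
    = m%:R * \sum_(j < m.+1) d j * d (m - j)%N.
  rewrite mulr_natl mulr2n {2}(sym m (fun j => j%:R)) -big_split/= mulr_sumr.
  by apply: eq_bigr => j _; rewrite -mulrDl -natrD subnKC// -ltnS.
have n0 : n.+1%:R != 0 :> K by rewrite pnatr_eq0.
apply: (mulfI n0); rewrite -wsum big_ord_recl/= mul0r add0r.
have -> : \sum_(i < n.+1) (bump 0 i)%:R * (d (bump 0 i) * d (n.+1 - bump 0 i)%N)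
   = \sum_(i < n.+1) (i%:R + 1 / 2) * (d i * d (n - i)%N).
  apply: eq_bigr => i _; rewrite /bump leq0n add1n subSS [LHS]mulrA [RHS]mulrA.
  by rewrite /d invsqrt_coefS.
rewrite (eq_bigr (fun i : 'I_n.+1 => i%:R * (d i * d (n - i)%N)
   + (1 / 2) * (d i * d (n - i)%N))); last by move=> i _; rewrite mulrDl.
rewrite big_split/= -mulr_sumr mulrDr wsum IH.
by rewrite -[n.+1%:R]natr1; field.
Qed.

Definition invsqrt_poly (K : numFieldType) (N : nat) : {poly K} :=
  \poly_(i < N) invsqrt_coef K i.

Lemma invsqrt_polyE (K : numFieldType) N (x : K) :
  (invsqrt_poly K N).[x] = \sum_(i < N) invsqrt_coef K i * x ^+ i.
Proof. by rewrite horner_poly. Qed.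

Lemma geometric_sum_le (K : numFieldType) (t : K) N : 0 <= t < 1 ->
  \sum_(i < N) t ^+ i <= (1 - t)^-1.
Proof.
move=> /andP[t0 t1].
rewrite -[leRHS]mul1r ler_pdivlMr ?subr_gt0// mulrC.
have -> : (1 - t) * \sum_(i < N) t ^+ i = 1 - t ^+ N.
  by rewrite -[1 in RHS](expr1n _ N) subrXX; congr (_ * _); apply: eq_bigr => i _;
    rewrite expr1n mul1r.
by rewrite gerBl exprn_ge0.
Qed.

(** By [invsqrt_coef_conv] the square of the truncation starts like the geometric
    series up to order N; the coefficients beyond it are nonnegative.  Asking for
    |x| <= t^2 rather than |x| <= t leaves a spare factor t^N on this tail, and
    the rest of the tail is bounded by the whole square evaluated at t. *)
Lemma invsqrt_poly_sqr_approx (K : numFieldType) N (t x : K) :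
  0 <= t < 1 -> `|x| <= t ^+ 2 ->
  `|(1 - x) * (invsqrt_poly K N).[x] ^+ 2 - 1| <= 3 * t ^+ N / (1 - t) ^+ 2.
Proof.
move=> /[dup] t01 /andP[t0 t1] xt.
set p := invsqrt_poly K N.
have xt1 : `|x| <= t by rewrite (le_trans xt)// expr2 ler_piMr// ltW.
have pE : p.[x] ^+ 2 = \sum_(i < N + N) (p * p)`_i * x ^+ i.
  rewrite expr2 -hornerM; apply: horner_coef_wide.
  rewrite (leq_trans (size_polyMleq _ _))//.
  by rewrite (leq_trans (leq_pred _))// leq_add// size_poly.
have pt : p.[t] ^+ 2 = \sum_(i < N + N) (p * p)`_i * t ^+ i.
  rewrite expr2 -hornerM; apply: horner_coef_wide.
  rewrite (leq_trans (size_polyMleq _ _))//.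
  by rewrite (leq_trans (leq_pred _))// leq_add// size_poly.
have c_ge0 i : 0 <= (p * p)`_i.
  rewrite coefM sumr_ge0// => j _; rewrite !coef_poly.
  by rewrite mulr_ge0//; case: ifP => // _; exact: invsqrt_coef_ge0.
have clow i : (i < N)%N -> (p * p)`_i = 1.
  move=> iN; rewrite coefM -[RHS](invsqrt_coef_conv K i).
  apply: eq_bigr => j _; rewrite !coef_poly.
  by rewrite (leq_ltn_trans _ iN) ?(leq_ltn_trans _ iN) ?leq_subr// -ltnS.
have split_low : (1 - x) * p.[x] ^+ 2 - 1 =
   - x ^+ N + (1 - x) * \sum_(i < N) (p * p)`_(N + i) * x ^+ (N + i).
  rewrite pE big_split_ord/= mulrDr.
  have -> : \sum_(i < N) (p * p)`_i * x ^+ i = \sum_(i < N) x ^+ i.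
    by apply: eq_bigr => i _; rewrite clow// mul1r.
  rewrite [(1 - x) * \sum_(i < N) x ^+ i](_ : _ = 1 - x ^+ N); first by ring.
  rewrite -[1 in RHS](expr1n _ N) subrXX; congr (_ * _); apply: eq_bigr => i _.
  by rewrite expr1n mul1r.
have pt_le : p.[t] <= (1 - t)^-1.
  apply: le_trans _ (geometric_sum_le _ _ N t01).
  rewrite invsqrt_polyE ler_sum// => i _.
  by rewrite ler_piMl ?exprn_ge0 ?invsqrt_coef_le1.
have pt_ge0 : 0 <= p.[t].
  rewrite invsqrt_polyE sumr_ge0// => i _.
  by rewrite mulr_ge0 ?exprn_ge0 ?invsqrt_coef_ge0.
have tail : `|\sum_(i < N) (p * p)`_(N + i) * x ^+ (N + i)|
    <= t ^+ N / (1 - t) ^+ 2.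
  apply: (@le_trans _ _ (t ^+ N * p.[t] ^+ 2)); last first.
    by rewrite ler_wpM2l ?exprn_ge0// -exprVn lerXn2r// nnegrE invr_ge0 subr_ge0 ltW.
  rewrite pt big_split_ord/= mulrDr.
  apply: (@le_trans _ _ (t ^+ N * \sum_(i < N) (p * p)`_(N + i) * t ^+ (N + i)));
    last first.
    rewrite lerDr mulr_ge0 ?exprn_ge0// sumr_ge0// => i _.
    by rewrite mulr_ge0// exprn_ge0.
  rewrite mulr_sumr (le_trans (ler_norm_sum _ _ _))// ler_sum// => i _.
  rewrite normrM (ger0_norm (c_ge0 _)) mulrCA ler_wpM2l// normrX.
  apply: (@le_trans _ _ ((t ^+ 2) ^+ (N + i))).
    by rewrite lerXn2r// nnegrE ?exprn_ge0.
  rewrite -exprM mulnC -exprD ler_wiXn2l// ?(ltW t1)//.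
  by rewrite muln2 -addnn leq_add2r leq_addr.
rewrite split_low (le_trans (ler_normD _ _))//.
rewrite normrN normrX normrM.
have h1 : `|x| ^+ N <= t ^+ N / (1 - t) ^+ 2.
  apply: (@le_trans _ _ (t ^+ N)); first by rewrite lerXn2r// nnegrE.
  rewrite ler_pdivlMr ?exprn_gt0 ?subr_gt0// ler_piMr ?exprn_ge0//.
  by rewrite exprn_ile1// ?subr_ge0 ?(ltW t1)// gerBl.
have h2 : `|1 - x| <= 2.
  rewrite (le_trans (ler_normB _ _))// normr1 -[2]/(1 + 1) lerD2l.
  by rewrite (le_trans xt1)// ltW.
have -> : 3 * t ^+ N / (1 - t) ^+ 2 =
  t ^+ N / (1 - t) ^+ 2 + 2 * (t ^+ N / (1 - t) ^+ 2) by rewrite -mulrA; ring.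
by rewrite lerD// ler_pM.
Qed.

(** * Unordered sums of products over multi-indices *)

Definition cube (n N : nat) : {fset {ffun 'I_n -> nat}} :=
  [fset [ffun j => nat_of_ord (f j)] | f : {ffun 'I_n -> 'I_N} in predT]%fset.

Lemma in_cube n N (m : {ffun 'I_n -> nat}) :
  (m \in cube n N) = [forall j, (m j < N)%N].
Proof.
apply/imfsetP/forallP => [[f _ ->] j|mN]; first by rewrite ffunE.
by exists [ffun j => Ordinal (mN j)] => //; apply/ffunP => j; rewrite !ffunE.
Qed.

Lemma big_cube_prod (K : comNzRingType) n N (F : 'I_n -> nat -> K) :
  \sum_(m <- cube n N) \prod_(j < n) F j (m j) =
  \prod_(j < n) \sum_(i < N) F j i.
Proof.
rewrite big_imfset /=; last first.
  move=> f g _ _ /ffunP fg; apply/ffunP => j.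
  by have := fg j; rewrite !ffunE => /val_inj.
rewrite bigA_distr_bigA /= big_enum_cond/=.
by apply: eq_big => [//|f _]; apply: eq_bigr => j _; rewrite ffunE.
Qed.

Lemma fset_sub_cube n (A : {fset {ffun 'I_n -> nat}}) :
  exists N, (A `<=` cube n N)%fset.
Proof.
exists (\max_(m <- A) \max_(j < n) m j).+1.
apply/fsubsetP => m mA; rewrite in_cube; apply/forallP => j; rewrite ltnS.
apply: (@leq_trans (\max_(j < n) m j)); first exact: leq_bigmax.
exact: leq_bigmax_seq.
Qed.

Lemma sum_fset_le (K : numDomainType) (I : choiceType) (A B : {fset I})
    (F : I -> K) :
  (A `<=` B)%fset -> (forall i, 0 <= F i) ->
  \sum_(i <- A) F i <= \sum_(i <- B) F i.
Proof.
move=> AB F0; rewrite [leRHS](big_fsetID _ (mem A))/=.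
have -> : [fset x in B | x \in A]%fset = A.
  apply/fsetP => x; rewrite !inE/= andbC; case xA : (x \in A) => //=.
  by rewrite (fsubsetP AB).
by rewrite lerDl sumr_ge0.
Qed.

(** A multi-index outside the cube has an entry at least N.  As in
    [invsqrt_poly_sqr_approx], half of the decay |w_j| <= t^2 pays for a factor
    t^N, while the other half bounds what remains by a product of n geometric
    series. *)
Lemma big_fset_prod_approx (K : numFieldType) n N (a : 'I_n -> nat -> K)
    (w : 'I_n -> K) (t : K) (A : {fset {ffun 'I_n -> nat}}) :
  0 <= t < 1 -> (forall j i, `|a j i| <= 1) -> (forall j, `|w j| <= t ^+ 2) ->
  (cube n N `<=` A)%fset ->
  `|\sum_(m <- A) \prod_(j < n) (a j (m j) * w j ^+ m j)
    - \prod_(j < n) \sum_(i < N) a j i * w j ^+ i| <= t ^+ N / (1 - t) ^+ n.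
Proof.
move=> /[dup] t01 /andP[t0 t1] a1 wt NA.
rewrite -(big_cube_prod _ _ _ (fun j i => a j i * w j ^+ i)).
rewrite (big_fsetID _ (mem (cube n N)))/=.
have -> : [fset x in A | x \in cube n N]%fset = cube n N.
  apply/fsetP => x; rewrite !inE/= andbC; case xA : (x \in cube n N) => //=.
  by rewrite (fsubsetP NA).
rewrite addrAC subrr add0r.
set B := [fset x in A | x \notin _]%fset.
apply: (@le_trans _ _ (\sum_(m <- B) t ^+ N * \prod_(j < n) t ^+ m j)).
  rewrite (le_trans (ler_norm_sum _ _ _))// big_seq [leRHS]big_seq ler_sum// => m.
  rewrite !inE/= => /andP[_]; rewrite in_cube negb_forall => /existsP[j0].
  rewrite -leqNgt => Nm.
  rewrite normr_prod.
  apply: (@le_trans _ _ (\prod_(j < n) (t ^+ m j * t ^+ m j))).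
    apply: ler_prod => j _; rewrite normr_ge0/= normrM normrX.
    rewrite -[leRHS]mul1r ler_pM// ?exprn_ge0//.
    rewrite -expr2 -exprM mulnC exprM.
    by rewrite lerXn2r// nnegrE ?exprn_ge0.
  rewrite big_split/= ler_wpM2r ?prodr_ge0// => [j _|]; first exact: exprn_ge0.
  rewrite (bigD1 j0)//= -[leRHS]mulr1 ler_pM ?exprn_ge0//.
  - by rewrite prodr_ge0// => j _; exact: exprn_ge0.
  - by rewrite ler_wiXn2l// ltW.
  - by rewrite prodr_ile1// => j; rewrite exprn_ge0//= exprn_ile1// ltW.
rewrite -mulr_sumr ler_wpM2l ?exprn_ge0//.
have [N' BN'] := fset_sub_cube _ B.
apply: (@le_trans _ _ (\sum_(m <- cube n N') \prod_(j < n) t ^+ m j)).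
  by apply: sum_fset_le => // m; rewrite prodr_ge0// => j _; exact: exprn_ge0.
rewrite (big_cube_prod _ _ _ (fun _ i => t ^+ i)) -exprVn.
rewrite -[in leRHS](card_ord n) -prodr_const ler_prod// => j _.
by rewrite geometric_sum_le// sumr_ge0// => i _; exact: exprn_ge0.
Qed.

(** * Moments of the Beta(3/2, 1/2) distribution *)

(** The mean of P for the Beta(3/2, 1/2) distribution, that is for the density
    (2/pi) u^(1/2) (1 - u)^(-1/2) on [0, 1], written with u = sin^2 t so that the
    integrand has no singularity. *)
Definition beta_mean (R : realType) (P : R -> R) : R :=
  4 / pi * \int[@lebesgue_measure R]_(t in `[0, pi / 2])
             (sin t ^+ 2 * P (sin t ^+ 2)).

Lemma integrable_quarter_period (R : realType) (f : R -> R) :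
  continuous f ->
  (@lebesgue_measure R).-integrable `[0, pi / 2] (EFin \o f).
Proof.
move=> cf; apply: continuous_compact_integrable; first exact: segment_compact.
exact: continuous_subspaceT.
Qed.

(** Wallis' recurrence: the derivative of sin^(n + 1) cos integrates to zero over
    a quarter period. *)
Lemma Rintegral_sinXSS (R : realType) n :
  n.+2%:R * \int[@lebesgue_measure R]_(t in `[0, pi / 2]) sin t ^+ n.+2 =
  n.+1%:R * \int[@lebesgue_measure R]_(t in `[0, pi / 2]) sin t ^+ n.
Proof.
have csin k : continuous (fun t : R => sin t ^+ k).
  by move=> t; apply: (@continuous_comp _ _ _ sin (fun u => u ^+ k));
    [exact: continuous_sin | exact: exprn_continuous].
(* f is the derivative of sin^(n + 1) cos, by cos^2 = 1 - sin^2. *)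
pose f (t : R) := n.+1%:R * sin t ^+ n - n.+2%:R * sin t ^+ n.+2.
have cZ k (c : R) : continuous (fun t : R => c * sin t ^+ k).
  by move=> t; apply: cvgM; [exact: cvg_cst | exact: csin].
have cf : continuous f by move=> t; apply: cvgB; exact: cZ.
have dF (t : R) : is_derive t 1 (sin ^+ n.+1 * cos) (f t).
  apply: is_derive_eq; rewrite /f /GRing.scale/= !fctE.
  have s2 := sin2cos2 t; set s := sin t in s2 *; set c := cos t in s2 *.
  have -> : n.+2%:R * s ^+ n.+2 = n.+1%:R * s ^+ n * s ^+ 2 + s ^+ n.+2.
    by rewrite -[n.+2%:R]natr1 mulrDl mul1r -mulrA -exprD addn2.
  by rewrite s2 !exprS; ring.
have dFd (t : R) : derivable (sin ^+ n.+1 * cos) t 1 by case: (dF t).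
have cF : continuous (sin ^+ n.+1 * cos : R -> R).
  by move=> t; exact/differentiable_continuous/derivable1_diffP.
have pi20 : 0 < pi / 2 :> R by rewrite divr_gt0// pi_gt0.
have := @continuous_FTC2 R f (sin ^+ n.+1 * cos) _ _ pi20.
move=> /(_ (continuous_subspaceT cf)) H.
have {H}/(congr1 fine) :
    (\int[@lebesgue_measure R]_(x in `[0%R, (pi / 2)%R]) (f x)%:E = 0)%E.
  rewrite H.
  - by rewrite !fctE cos_pihalf sin0 mulr0 expr0n/= mul0r subee.
  - split => [t _||]; first exact: dFd.
      by apply: cvg_at_right_filter; exact: cF.
    by apply: cvg_at_left_filter; exact: cF.
  - by move=> t _; rewrite derive1E; apply: derive_val.
rewrite -/(Rintegral _ _ _) /f RintegralB//; try exact: integrable_quarter_period.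
rewrite !RintegralZl//; try exact: integrable_quarter_period.
by move/eqP; rewrite subr_eq0 => /eqP.
Qed.

Lemma beta_meanX (R : realType) (M : nat) :
  beta_mean R (fun u => u ^+ M) = pochhammer (3 / 2) M / pochhammer 2 M.
Proof.
have pi0 : pi != 0 :> R by rewrite gt_eqF// pi_gt0.
rewrite /beta_mean.
under eq_Rintegral do rewrite -exprS -exprM.
elim: M => [|M IH].
  rewrite muln1 /pochhammer !big_nil divr1.
  have := @Rintegral_sinXSS R 0.
  under [in RHS]eq_Rintegral do rewrite expr0.
  rewrite Rintegral_cst//= lebesgue_measure_itv/= lte_fin divr_gt0 ?pi_gt0//=.
  have n2 : 2 != 0 :> R by rewrite pnatr_eq0.
  rewrite !mul1r subr0 => /(canRL (mulKf n2)) ->.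
  by move: (@pi R) pi0 => p p0; field.
rewrite !pochhammerS invfM mulrACA -IH.
have := @Rintegral_sinXSS R (2 * M.+1).
rewrite (_ : (2 * M.+1).+2 = 2 * M.+2)%N; last by rewrite !mulnS.
have c0 : (2 * M.+2)%:R != 0 :> R by rewrite pnatr_eq0.
move=> /(canRL (mulKf c0)) ->.
have M2 : 2 + M%:R != 0 :> R by rewrite -natrD pnatr_eq0.
have e1 : (2 * M.+2)%:R = 2 * (2 + M%:R) :> R.
  by rewrite natrM -[M.+2]addn2 natrD [M%:R + _]addrC.
have e2 : (2 * M.+1).+1%:R = 2 * (3 / 2 + M%:R) :> R.
  by rewrite -natr1 natrM -[M.+1%:R]natr1; field.
rewrite e1 e2; move: (Rintegral _ _ _) => J.
by move: (@pi R) pi0 => p p0; field; rewrite p0 M2.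
Qed.

Section beta_mean_linear.
Variable R : realType.
Implicit Types P Q : R -> R.

Let cont P := continuous (fun t : R => P (sin t ^+ 2)).

Let cont_weight P : cont P -> continuous (fun t : R => sin t ^+ 2 * P (sin t ^+ 2)).
Proof.
move=> cP t; apply: cvgM; last exact: cP.
by apply: (@continuous_comp _ _ _ sin (fun u => u ^+ 2));
  [exact: continuous_sin | exact: exprn_continuous].
Qed.

Lemma beta_meanB P Q : cont P -> cont Q ->
  beta_mean R (fun u => P u - Q u) = beta_mean R P - beta_mean R Q.
Proof.
move=> cP cQ; rewrite /beta_mean -mulrBr -RintegralB//;
  try exact/integrable_quarter_period/cont_weight.
by under eq_Rintegral do rewrite mulrBr.
Qed.

Lemma beta_meanD P Q : cont P -> cont Q ->
  beta_mean R (fun u => P u + Q u) = beta_mean R P + beta_mean R Q.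
Proof.
move=> cP cQ; rewrite /beta_mean -mulrDr -RintegralD//;
  try exact/integrable_quarter_period/cont_weight.
by under eq_Rintegral do rewrite mulrDr.
Qed.

Lemma beta_meanZ k P : cont P ->
  beta_mean R (fun u => k * P u) = k * beta_mean R P.
Proof.
move=> cP; rewrite /beta_mean [RHS]mulrCA -[k * _]RintegralZl//;
  try exact/integrable_quarter_period/cont_weight.
by congr (_ * _); apply: eq_Rintegral => t _; rewrite mulrCA.
Qed.

Lemma le_beta_mean P Q : cont P -> cont Q ->
  (forall u, 0 <= u <= 1 -> P u <= Q u) -> beta_mean R P <= beta_mean R Q.
Proof.
move=> cP cQ PQ; rewrite /beta_mean ler_wpM2l ?divr_ge0 ?pi_ge0//.
apply: le_Rintegral => //; try exact/integrable_quarter_period/cont_weight.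
move=> t _; rewrite ler_wpM2l ?sqr_ge0// PQ// sqr_ge0/=.
by rewrite -[leRHS](cos2Dsin2 t) lerDr sqr_ge0.
Qed.

Lemma beta_mean_cst (k : R) : beta_mean R (fun=> k) = k.
Proof.
have -> : (fun=> k) = (fun u : R => k * u ^+ 0).
  by apply/funext => u; rewrite expr0 mulr1.
rewrite beta_meanZ; last by move=> t; under eq_fun do rewrite expr0; exact: cvg_cst.
by rewrite beta_meanX /pochhammer !big_nil divr1 mulr1.
Qed.

(** The exchange of sum and integral, for finite sums: beta_mean is a positive
    linear functional with beta_mean 1 = 1, so a uniform approximation of P by a
    polynomial passes to the moments with the same error. *)
Lemma beta_mean_sum_approx (I : Type) (r : seq I) (a : I -> R) (M : I -> nat)
    P (e : R) : cont P ->
  (forall u, 0 <= u <= 1 -> `|\sum_(i <- r) a i * u ^+ M i - P u| <= e) ->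
  `|\sum_(i <- r) a i * (pochhammer (3 / 2) (M i) / pochhammer 2 (M i))
    - beta_mean R P| <= e.
Proof.
move=> cP aP.
have cX k : cont (fun u => u ^+ k).
  rewrite /cont.
  have -> : (fun t : R => (sin t ^+ 2) ^+ k) = (fun t => sin t ^+ (2 * k)).
    by apply/funext => t; rewrite exprM.
  move=> t; apply: (@continuous_comp _ _ _ sin (fun u => u ^+ (2 * k))).
    exact: continuous_sin.
  exact: exprn_continuous.
have cZX i : cont (fun u => a i * u ^+ M i).
  by move=> t; apply: cvgM; [exact: cvg_cst | exact: cX].
have [cS ->] : cont (fun u => \sum_(i <- r) a i * u ^+ M i) /\
    \sum_(i <- r) a i * (pochhammer (3 / 2) (M i) / pochhammer 2 (M i)) =
    beta_mean R (fun u => \sum_(i <- r) a i * u ^+ M i).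
  elim: r {aP} => [|i r [cS IH]].
    rewrite big_nil.
    have -> : (fun u : R => \sum_(i <- [::]) a i * u ^+ M i) = (fun=> 0).
      by apply/funext => u; rewrite big_nil.
    by split; [move=> t; exact: cvg_cst | rewrite beta_mean_cst].
  rewrite big_cons IH.
  have -> : (fun u : R => \sum_(j <- i :: r) a j * u ^+ M j) =
      (fun u => a i * u ^+ M i + \sum_(j <- r) a j * u ^+ M j).
    by apply/funext => u; rewrite big_cons.
  split; first by move=> t; apply: cvgD; [exact: cZX | exact: cS].
  rewrite beta_meanD; [|exact: cZX|exact: cS].
  by rewrite beta_meanZ ?beta_meanX//; exact: cX.
have cD : cont (fun u => \sum_(i <- r) a i * u ^+ M i - P u).
  by move=> t; apply: cvgB; [exact: cS | exact: cP].
have cc k : cont (fun=> k) by move=> t; exact: cvg_cst.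
rewrite -beta_meanB// ler_norml -[in - e](beta_mean_cst (- e)) -{2}(beta_mean_cst e).
by apply/andP; split; apply: le_beta_mean => // u /aP; rewrite ler_norml => /andP[].
Qed.

End beta_mean_linear.

(** * Lauricella series as a Beta mean *)

Lemma pochhammer_real_complex (R : realType) (x : R) n :
  pochhammer x%:C n = (pochhammer x n)%:C.
Proof.
rewrite /pochhammer rmorph_prod/=; apply: eq_bigr => i _.
by rewrite rmorphD rmorph_nat.
Qed.

Lemma normc_Re_le (R : realType) (z : R[i]) (e : R) :
  `|z| <= e%:C -> `|complex.Re z| <= e.
Proof.
rewrite normc_def lecR; apply: le_trans.
by rewrite -sqrtr_sqr ler_wsqrtr// lerDl sqr_ge0.
Qed.

Lemma normc_Im_le (R : realType) (z : R[i]) (e : R) :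
  `|z| <= e%:C -> `|complex.Im z| <= e.
Proof.
rewrite normc_def lecR; apply: le_trans.
by rewrite -sqrtr_sqr ler_wsqrtr// lerDr sqr_ge0.
Qed.

Lemma normc_le_ReIm (R : realType) (z : R[i]) (e f : R) :
  `|complex.Re z| <= e -> `|complex.Im z| <= f -> `|z| <= (e + f)%:C.
Proof.
move=> re im; rewrite [z in `|z|]complexE (le_trans (ler_normD _ _))//.
rewrite normrM rmorphD lerD//.
  by rewrite normc_def/= expr0n/= addr0 sqrtr_sqr lecR.
by rewrite !normc_def/= expr0n/= expr1n add0r sqrtr1 mul1r addr0 sqrtr_sqr lecR.
Qed.

Lemma lauricella_half_term (R : realType) n (beta x : n.-tuple R[i]) m :
  (forall j, tnth beta j = 1 / 2) ->
  lauricellaFD_term (3 / 2) beta 2 x m =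
  (pochhammer (3 / 2 : R) (\sum_(j < n) m j)
    / pochhammer 2 (\sum_(j < n) m j))%:C *
  \prod_(j < n) (invsqrt_coef R[i] (m j) * tnth x j ^+ m j).
Proof.
move=> bE; rewrite /lauricellaFD_term.
set M := (\sum_(j < n) m j)%N.
have -> : \prod_(j < n) pochhammer (tnth beta j) (m j) =
    \prod_(j < n) pochhammer (1 / 2 : R[i]) (m j).
  by apply: eq_bigr => j _; rewrite bE.
have -> : (3 / 2 : R[i]) = (3 / 2)%:C by rewrite rmorphM fmorphV !rmorph_nat.
have -> : pochhammer (2 : R[i]) M = (pochhammer 2 M)%:C.
  by rewrite -pochhammer_real_complex rmorph_nat.
rewrite pochhammer_real_complex [in RHS]rmorphM/= fmorphV/= big_split/=.
have -> : \prod_(j < n) invsqrt_coef R[i] (m j) =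
   (\prod_(j < n) pochhammer (1 / 2 : R[i]) (m j)) / \prod_(j < n) (m j)`!%:R.
  by rewrite prodf_div.
by rewrite invfM; ring.
Qed.

(** The partial sum over a finite set A of multi-indices is linear in the moments
    of [beta_mean], so real and imaginary parts reduce to
    [beta_mean_sum_approx].  As soon as A contains a large enough cube, the
    integrand is uniformly close to the product of the truncated binomial series
    by [big_fset_prod_approx]. *)
Lemma lauricella_half_beta_mean (R : realType) n (beta x : n.-tuple R[i])
    (t : R) (P : R -> R) :
  0 <= t < 1 ->
  (forall j, tnth beta j = 1 / 2) ->
  (forall j, `|tnth x j| <= (t ^+ 2)%:C) ->
  continuous (fun a : R => P (sin a ^+ 2)) ->
  (forall e : R, 0 < e -> \forall N \near \oo, forall u : R, 0 <= u <= 1 ->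
    `|\prod_(j < n) (invsqrt_poly R[i] N).[tnth x j * u%:C] - (P u)%:C| <= e%:C) ->
  lauricellaFD (3 / 2) beta 2 x = (beta_mean R P)%:C.
Proof.
move=> /andP[t0 t1] bE xt cP hP.
apply: (@cvg_lim R[i]^o (@norm_hausdorff _ R[i]^o) _ _ summability.totally_filter).
have FF := @summability.totally_filter {ffun 'I_n -> nat}.
apply/cvgrPdist_le => e e0.
have [d eE] : exists d : R, e = d%:C.
  by apply/complex_realP/ger0_real/ltW.
have d0 : 0 < d by move: e0; rewrite eE (ltcR 0).
have d40 : 0 < d / 4 by rewrite divr_gt0.
have [N0 _ N0P] := hP _ d40.
have [N1 _ N1P] : \forall N \near \oo, t ^+ N / (1 - t) ^+ n <= d / 4.
  have c1 : t ^+ N / (1 - t) ^+ n @[N --> \oo] --> 0 / (1 - t) ^+ n.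
    by apply: cvgMr_tmp; apply: cvg_expr; rewrite ger0_norm.
  rewrite mul0r in c1; move/cvgrPdist_le : c1 => /(_ _ d40); apply: filterS => N.
  by rewrite sub0r normrN => /(le_trans (ler_norm _)).
pose N := maxn N0 N1.
exists (cube n N) => // A /= NA.
rewrite /summability.partial_sum -(big_seq_fsetE _ _ xpredT)/=.
pose c M : R := pochhammer (3 / 2) M / pochhammer 2 M.
pose Z (m : {ffun 'I_n -> nat}) : R[i] :=
  \prod_(j < n) (invsqrt_coef R[i] (m j) * tnth x j ^+ m j).
pose M (m : {ffun 'I_n -> nat}) : nat := \sum_(j < n) m j.
have approx (u : R) : 0 <= u <= 1 ->
    `|\sum_(m <- A) Z m * (u ^+ M m)%:C - (P u)%:C| <= (d / 2)%:C.
  move=> /[dup] u01 /andP[u0 u1].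
  (* One quarter for the truncation to the cube, one for the limit. *)
  have -> : d / 2 = d / 4 + d / 4 by field.
  pose w j := tnth x j * u%:C.
  have wt j : `|w j| <= t%:C ^+ 2.
    rewrite /w normrM -rmorphXn/= -[leRHS]mulr1 ler_pM//.
    by rewrite ger0_norm ?(lecR 0)// (lecR _ 1).
  have ZE : \sum_(m <- A) Z m * (u ^+ M m)%:C =
      \sum_(m <- A) \prod_(j < n) (invsqrt_coef R[i] (m j) * w j ^+ m j).
    apply: eq_bigr => m _; rewrite /Z /M rmorphXn/= -prodrXr -big_split/=.
    by apply: eq_bigr => j _; rewrite /w exprMn mulrA.
  rewrite ZE -(subrK (\prod_(j < n) (invsqrt_poly R[i] N).[w j])
    (\sum_(m <- A) _)) -addrA rmorphD (le_trans (ler_normD _ _))// lerD//.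
    apply: (@le_trans _ _ (t%:C ^+ N / (1 - t%:C) ^+ n)).
      under [X in _ - X]eq_bigr do rewrite invsqrt_polyE.
      apply: (big_fset_prod_approx _ _ _ (fun _ i => invsqrt_coef R[i] i)) => //.
      - by rewrite (lecR 0) (ltcR _ 1) t0.
      - by move=> _ i; rewrite ger0_norm ?invsqrt_coef_ge0 ?invsqrt_coef_le1.
    rewrite -[1]/(1%:C) -rmorphB -!rmorphXn -fmorphV -rmorphM lecR.
    by apply: N1P; rewrite /= leq_maxr.
  by apply: N0P => //; rewrite /= leq_maxl.
have -> : \sum_(m <- A) lauricellaFD_term (3 / 2) beta 2 x m =
    \sum_(m <- A) (c (M m))%:C * Z m.
  by apply: eq_bigr => m _; rewrite lauricella_half_term.
have ReE (g : {ffun 'I_n -> nat} -> R) : complex.Re (\sum_(m <- A) Z m * (g m)%:C) =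
    \sum_(m <- A) complex.Re (Z m) * g m.
  rewrite (raddf_sum (@complex.Re R : Rcomplex R -> R))/=; apply: eq_bigr => m _.
  by case: (Z m) => p q /=; rewrite mulr0 subr0.
have ImE (g : {ffun 'I_n -> nat} -> R) : complex.Im (\sum_(m <- A) Z m * (g m)%:C) =
    \sum_(m <- A) complex.Im (Z m) * g m.
  rewrite (raddf_sum (@complex.Im R : Rcomplex R -> R))/=; apply: eq_bigr => m _.
  by case: (Z m) => p q /=; rewrite mulr0 add0r.
have -> : \sum_(m <- A) (c (M m))%:C * Z m = \sum_(m <- A) Z m * (c (M m))%:C.
  by apply: eq_bigr => m _; rewrite mulrC.
rewrite distrC eE (_ : d = d / 2 + d / 2); last by field.
apply: normc_le_ReIm.
  rewrite raddfB/= ReE.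
  apply: beta_mean_sum_approx => // u u01.
  have /normc_Re_le := approx u u01.
  by rewrite raddfB/= ReE.
rewrite raddfB/= ImE subr0.
have := @beta_mean_sum_approx R _ A (fun m => complex.Im (Z m)) M (fun=> 0) (d / 2).
rewrite beta_mean_cst subr0; apply.
  by move=> s; exact: cvg_cst.
move=> u u01; have /normc_Im_le := approx u u01.
by rewrite raddfB/= ImE.
Qed.

(** * Two conjugate arguments and the square of their modulus *)

Lemma invsqrt_coef_real_complex (R : realType) n :
  invsqrt_coef R[i] n = (invsqrt_coef R n)%:C.
Proof.
rewrite /invsqrt_coef rmorphM/= fmorphV/= rmorph_nat -pochhammer_real_complex.
by rewrite rmorphM/= fmorphV/= rmorph_nat rmorph1.
Qed.

Lemma invsqrt_poly_real_complex (R : realType) N (y : R) :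
  (invsqrt_poly R[i] N).[y%:C] = ((invsqrt_poly R N).[y])%:C.
Proof.
rewrite !invsqrt_polyE rmorph_sum/=; apply: eq_bigr => i _.
by rewrite invsqrt_coef_real_complex [RHS]rmorphM/= rmorphXn.
Qed.

Lemma invsqrt_poly_conj (R : realType) N (z : R[i]) :
  (invsqrt_poly R[i] N).[z^*%C] = ((invsqrt_poly R[i] N).[z])^*%C.
Proof.
rewrite !invsqrt_polyE rmorph_sum/=; apply: eq_bigr => i _.
rewrite invsqrt_coef_real_complex; move: (invsqrt_coef R i) => k.
by rewrite [RHS]rmorphM/= rmorphXn/= oppr0.
Qed.

(** Closeness to 1 is lost by no more than a constant factor when taking the
    square root of a product, because |X - 1| <= |X^2 - 1| for X >= 0. *)
Lemma dist1_le_of_sqr (R : realType) (A B X d : R) :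
  0 <= d <= 1 -> `|A - 1| <= d -> `|B - 1| <= d -> 0 <= X ->
  X ^+ 2 = A * B ^+ 2 -> `|X - 1| <= 7 * d.
Proof.
move=> /andP[d0 d1] /[dup] hA Ad Bd X0 XE.
have leB : `|B ^+ 2 - 1| <= 3 * d.
  have -> : B ^+ 2 - 1 = (B + 1) * (B - 1) by ring.
  rewrite normrM ler_pM//; move: Bd; rewrite ler_norml => /andP[? ?].
  by rewrite ger0_norm; lra.
have leX : `|X ^+ 2 - 1| <= 7 * d.
  have -> : X ^+ 2 - 1 = A * (B ^+ 2 - 1) + (A - 1) by rewrite XE; ring.
  rewrite (le_trans (ler_normD _ _))// (_ : 7 * d = 2 * (3 * d) + d); last by ring.
  rewrite lerD// normrM ler_pM//.
  by move: hA; rewrite ler_norml => /andP[? ?]; rewrite ger0_norm; lra.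
apply: le_trans leX.
have -> : X ^+ 2 - 1 = (X + 1) * (X - 1) by ring.
by rewrite normrM ler_peMl// ger0_norm; lra.
Qed.

(** With h = |p(z)|^2, both (1 - y) p(y)^2 and |1 - z| h are close to 1; the second
    follows from the estimate of (1 - z) p(z)^2 by taking moduli. *)
Lemma invsqrt_poly_prod_approx (R : realType) N (t y : R) (z : R[i]) :
  0 <= t < 1 -> 0 <= y <= t ^+ 2 -> `|z| <= (t ^+ 2)%:C ->
  3 * t ^+ N / (1 - t) ^+ 2 <= 1 ->
  `|(invsqrt_poly R[i] N).[y%:C] *
      ((invsqrt_poly R[i] N).[z^*%C] * (invsqrt_poly R[i] N).[z])
    - ((Num.sqrt (1 - y) * ComplexField.Normc.normc (1 - z))^-1)%:C|
  <= (7 * (3 * t ^+ N / (1 - t) ^+ 2) / (1 - t) ^+ 2)%:C.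
Proof.
move=> /[dup] t01 /andP[t0 t1] /andP[y0 yt] zt.
set d := (3 * t ^+ N / (1 - t) ^+ 2) => d1; set p := invsqrt_poly R[i] N.
have d0 : 0 <= d.
  by rewrite divr_ge0 ?exprn_ge0 ?subr_ge0 ?(ltW t1)// mulr_ge0 ?exprn_ge0.
have t1' : 0 < 1 - t by rewrite subr_gt0.
have y_lt1 : 1 - t <= 1 - y.
  by rewrite lerD2l lerN2 (le_trans yt)// expr2 ler_piMr// ltW.
pose g := (invsqrt_poly R N).[y].
pose nz := ComplexField.Normc.normc (1 - z).
pose h := ComplexField.Normc.normc p.[z] ^+ 2.
have normcE (w : R[i]) : `|w| = (ComplexField.Normc.normc w)%:C by [].
have g0 : 0 <= g.
  rewrite /g invsqrt_polyE sumr_ge0// => i _.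
  by rewrite mulr_ge0 ?exprn_ge0 ?invsqrt_coef_ge0.
have h0 : 0 <= h by rewrite sqr_ge0.
have phE : p.[z^*%C] * p.[z] = h%:C.
  by rewrite invsqrt_poly_conj mulrC -sqr_normc normcE -rmorphXn.
have pgE : p.[y%:C] = g%:C by rewrite invsqrt_poly_real_complex.
have nz_ge : 1 - t <= nz.
  rewrite -lecR -normcE rmorphB/= (le_trans _ (lerB_dist _ _))// normr1 lerD2l lerN2.
  by rewrite (le_trans zt)// lecR expr2 ler_piMr// ltW.
have nz0 : 0 < nz := lt_le_trans t1' nz_ge.
have sy_ge : 1 - t <= Num.sqrt (1 - y).
  have sy0 : 0 <= 1 - y by rewrite (le_trans _ y_lt1)// ltW.
  rewrite (le_trans y_lt1)// -[leLHS]sqr_sqrtr// expr2 ler_piMl ?sqrtr_ge0//.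
  by rewrite -[leRHS]sqrtr1 ler_wsqrtr// gerBl.
have sy0 : 0 < Num.sqrt (1 - y) := lt_le_trans t1' sy_ge.
have Ad : `|(1 - y) * g ^+ 2 - 1| <= d.
  by apply: invsqrt_poly_sqr_approx => //; rewrite ger0_norm.
have Bd : `|nz * h - 1| <= d.
  have := invsqrt_poly_sqr_approx R[i] N t%:C z.
  have -> : 3 * t%:C ^+ N / (1 - t%:C) ^+ 2 = d%:C.
    by rewrite /d !rmorphM fmorphV !rmorphXn rmorphB/= rmorph_nat.
  rewrite (lecR 0) (ltcR _ 1) -rmorphXn => /(_ t01 zt).
  move=> /(le_trans (ler_dist_dist _ _)).
  rewrite normr1 normrM normrX (normcE (1 - z)) (normcE p.[z]).
  rewrite -rmorphXn -rmorphM -[X in _ - X]/(1%:C) -rmorphB.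
  by rewrite normc_def/= expr0n/= addr0 sqrtr_sqr lecR.
pose D := Num.sqrt (1 - y) * nz.
have D0 : 0 < D by rewrite mulr_gt0.
have XX : `|g * h * D - 1| <= 7 * d.
  apply: (dist1_le_of_sqr _ _ _ _ _ _ Ad Bd); rewrite ?d0//.
    exact: mulr_ge0 (mulr_ge0 g0 h0) (ltW D0).
  rewrite /D !exprMn sqr_sqrtr; first by ring.
  by rewrite (le_trans _ y_lt1)// ltW.
rewrite phE pgE -rmorphM -rmorphB -/D normc_def/= expr0n/= addr0 sqrtr_sqr lecR.
have -> : g * h - D^-1 = (g * h * D - 1) / D by field; rewrite gt_eqF.
rewrite normrM ler_pM// normfV gtr0_norm// lef_pV2 ?posrE ?exprn_gt0//.
by rewrite expr2 ler_pM// ltW.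
Qed.

(** The product of (1 - x u)^(-1/2) over x = r^2, r e^(-i phi), r e^(i phi), where
    c = cos phi. *)
Definition lauricella3_density (R : realType) (r c u : R) : R :=
  (Num.sqrt (1 - r ^+ 2 * u) *
   Num.sqrt (1 - 2 * r * c * u + r ^+ 2 * u ^+ 2))^-1.

Lemma lauricella3_radicands (R : realType) (r c u : R) :
  0 <= r < 1 -> -1 <= c <= 1 -> 0 <= u <= 1 ->
  0 < 1 - r ^+ 2 * u <= 1 /\ 0 < 1 - 2 * r * c * u + r ^+ 2 * u ^+ 2 <= 2 ^+ 2.
Proof.
move=> /andP[r0 r1] /andP[c0 c1] /andP[u0 u1].
have ru0 : 0 <= r * u by exact: mulr_ge0.
have ru1 : r * u < 1 by rewrite (le_lt_trans _ r1)// ler_piMr.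
split; apply/andP; split.
- by rewrite subr_gt0 (le_lt_trans _ ru1)// ler_wpM2r// expr2 ler_piMr// ltW.
- by rewrite gerBl mulr_ge0// sqr_ge0.
- have h1 : 0 < (1 - r * u) ^+ 2 by rewrite exprn_gt0// subr_gt0.
  have h2 : 0 <= r * u * (1 - c) by rewrite mulr_ge0// subr_ge0.
  by nra.
- have h1 : (1 + r * u) ^+ 2 <= 2 ^+ 2 by rewrite lerXn2r ?nnegrE; lra.
  have h2 : 0 <= r * u * (1 + c) by rewrite mulr_ge0// addrC -lerBlDr sub0r.
  by nra.
Qed.

Lemma continuous_lauricella3_density_sin (R : realType) (r c : R) :
  0 <= r < 1 -> -1 <= c <= 1 ->
  continuous (fun a : R => lauricella3_density R r c (sin a ^+ 2)).
Proof.
move=> r01 c1 a; set u := sin a ^+ 2.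
have u01 : 0 <= u <= 1.
  by rewrite sqr_ge0/= -[leRHS](cos2Dsin2 a) lerDr sqr_ge0.
have [/andP[f1 _] /andP[f2 _]] := lauricella3_radicands R r c u r01 c1 u01.
apply: cvgV; first by rewrite mulf_neq0// gt_eqF// sqrtr_gt0.
have cu : (sin x ^+ 2 @[x --> a] --> u).
  by apply: cvgM; exact: continuous_sin.
apply: cvgM; apply: continuous_cvg; try exact: sqrt_continuous.
  by apply: cvgB; [exact: cvg_cst | apply: cvgM; [exact: cvg_cst|exact: cu]].
apply: cvgD; last by apply: cvgM; [exact: cvg_cst | apply: cvgM; exact: cu].
by apply: cvgB; [exact: cvg_cst | apply: cvgM; [exact: cvg_cst|exact: cu]].
Qed.

Lemma beta_mean_lauricella3_density_gt0 (R : realType) (r c : R) :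
  0 <= r < 1 -> -1 <= c <= 1 -> 0 < beta_mean R (lauricella3_density R r c).
Proof.
move=> r01 c1; apply: (@lt_le_trans _ _ (beta_mean R (fun=> 2^-1))).
  by rewrite beta_mean_cst invr_gt0.
apply: le_beta_mean.
- by move=> t; exact: cvg_cst.
- exact: continuous_lauricella3_density_sin.
move=> u u01.
have [/andP[f1 f1'] /andP[f2 f2']] := lauricella3_radicands R r c u r01 c1 u01.
rewrite /lauricella3_density lef_pV2 ?posrE ?mulr_gt0 ?sqrtr_gt0//.
rewrite -[leRHS]mul1r ler_pM ?sqrtr_ge0//.
  by rewrite -[leRHS]sqrtr1 ler_wsqrtr.
by rewrite -[leRHS]ger0_norm// -sqrtr_sqr ler_wsqrtr.
Qed.

Lemma lauricella3_beta_mean (R : realType) (r c s : R) :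
  0 <= r < 1 -> c ^+ 2 + s ^+ 2 = 1 ->
  lauricellaFD (3 / 2) [tuple 1 / 2; 1 / 2; 1 / 2] 2
    [tuple (r ^+ 2)%:C; r%:C * (c -i* s); r%:C * (c +i* s)] =
  (beta_mean R (lauricella3_density R r c))%:C.
Proof.
move=> /[dup] r01 /andP[r0 r1] cs.
have cI : -1 <= c <= 1 by have s2 := sqr_ge0 s; apply/andP; split; nra.
(* The estimates are stated for arguments of modulus at most t^2. *)
pose t := Num.sqrt r.
have t0 : 0 <= t by exact: sqrtr_ge0.
have tr : t ^+ 2 = r by rewrite sqr_sqrtr.
have t1 : t < 1 by rewrite -[ltRHS]sqrtr1 ltr_sqrt.
have norm_z (w : R[i]) : w \in [:: c -i* s; c +i* s] -> `|r%:C * w| = r%:C.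
  have rr : `|r%:C| = r%:C by rewrite ger0_norm// (lecR 0).
  rewrite !inE => /orP[]/eqP ->.
    by rewrite normrM rr normc_def/= sqrrN cs sqrtr1 mulr1.
  by rewrite normrM rr normc_def/= cs sqrtr1 mulr1.
have zu (u : R) : 1 - r%:C * (c +i* s) * u%:C = (1 - r * c * u) +i* (- (r * s * u)).
  by apply/eqP; rewrite eq_complex/=; apply/andP; split; apply/eqP; ring.
have DE (u : R) : ComplexField.Normc.normc (1 - r%:C * (c +i* s) * u%:C) =
    Num.sqrt (1 - 2 * r * c * u + r ^+ 2 * u ^+ 2).
  rewrite zu/=; congr Num.sqrt.
  apply/eqP; rewrite -subr_eq0; apply/eqP.
  transitivity (r ^+ 2 * u ^+ 2 * (c ^+ 2 + s ^+ 2 - 1)); first by ring.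
  by rewrite cs subrr mulr0.
have conjE (u : R) : r%:C * (c -i* s) * u%:C = (r%:C * (c +i* s) * u%:C)^*%C.
  by apply/eqP; rewrite eq_complex/=; apply/andP; split; apply/eqP; ring.
have in1 (u : R) : 0 <= u <= 1 -> 0 <= r ^+ 2 * u <= t ^+ 2.
  move=> /andP[u0 u1]; rewrite tr mulr_ge0 ?sqr_ge0//= -[leRHS]mulr1.
  by rewrite ler_pM ?sqr_ge0// expr2 ler_piMr// ltW.
have in2 (u : R) : 0 <= u <= 1 -> `|r%:C * (c +i* s) * u%:C| <= (t ^+ 2)%:C.
  move=> /andP[u0 u1]; rewrite normrM norm_z ?inE ?eqxx ?orbT// tr.
  by rewrite ger0_norm ?(lecR 0)// -rmorphM lecR ler_piMr.
apply: (@lauricella_half_beta_mean R 3 _ _ t).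
- by rewrite t0 t1.
- by case=> -[|[|[|]]].
- case=> -[|[|[|//]]] j; rewrite /tnth/= tr.
  + rewrite ger0_norm ?(lecR 0) ?sqr_ge0// lecR expr2 ler_piMr//.
    exact: ltW.
  + by rewrite norm_z// inE eqxx.
  + by rewrite norm_z// !inE eqxx orbT.
- exact: continuous_lauricella3_density_sin.
- move=> e e0.
  have c1 : 3 * t ^+ N / (1 - t) ^+ 2 @[N --> \oo] --> 3 * 0 / (1 - t) ^+ 2.
    apply: cvgMr_tmp; apply: cvgMl_tmp; apply: cvg_expr; rewrite ger0_norm//.
  rewrite mulr0 mul0r in c1; move/cvgrPdist_le : c1 => c1.
  have e'0 : 0 < e * (1 - t) ^+ 2 / 7.
    by rewrite divr_gt0// mulr_gt0// exprn_gt0// subr_gt0.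
  have := c1 _ e'0; have := c1 _ (@ltr01 R); apply: filterS2 => N.
  rewrite !sub0r !normrN => /(le_trans (ler_norm _)) N1 /(le_trans (ler_norm _)) N2.
  move=> u u01.
  have := invsqrt_poly_prod_approx R N t (r ^+ 2 * u)
    (r%:C * (c +i* s) * u%:C) _ (in1 u u01) (in2 u u01) N1.
  rewrite t0 t1 => /(_ isT); rewrite DE. rewrite -conjE.
  have -> : \prod_(j < 3) (invsqrt_poly R[i] N).[tnth [tuple (r ^+ 2)%:C;
        r%:C * (c -i* s); r%:C * (c +i* s)] j * u%:C] =
      (invsqrt_poly R[i] N).[(r ^+ 2 * u)%:C] *
      ((invsqrt_poly R[i] N).[r%:C * (c -i* s) * u%:C] *
       (invsqrt_poly R[i] N).[r%:C * (c +i* s) * u%:C]).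
    rewrite !big_ord_recl big_ord0 mulr1 /tnth/=.
    by rewrite -(rmorphM (real_complex R)).
  move=> /le_trans; apply; rewrite lecR ler_pdivrMr ?exprn_gt0 ?subr_gt0//.
  by rewrite mulrC -ler_pdivlMr.
Qed.

(** * Change of variables on a half-open interval *)

(** The function f may be unbounded near F b.  Ordinary substitution applies on
    [a, u_n] with u_n increasing to b, and monotone convergence on both sides
    gives the limit. *)
Lemma integral_subst_itvco (R : realType) (F F' f : R -> R) (a b : R) :
  a < b -> (forall x : R, is_derive x 1 F (F' x)) -> continuous F' ->
  {in `[a, b[, forall x, 0 < F' x} ->
  {in `[F a, F b[, continuous f} -> {in `[F a, F b[, forall x, 0 <= f x} ->
  (\int[@lebesgue_measure R]_(x in `[F a, F b[) (f x)%:E =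
   \int[@lebesgue_measure R]_(x in `[a, b[) (f (F x) * F' x)%:E)%E.
Proof.
move=> ab dF cF' F'gt0 cf f0.
have F'E : derive1 F = F'.
  by apply/funext => x; rewrite derive1E; apply: derive_val.
have dF1 (x : R) : derivable F x 1 by case: (dF x).
have cF : continuous F.
  by move=> x; exact/differentiable_continuous/derivable1_diffP.
have incF : {in `[a, b] &, {homo F : x y / x < y}}.
  apply: gtr0_derive1_lt_cc => // [x xab|]; last exact: continuous_subspaceT.
  by rewrite F'E F'gt0//; exact: subset_itv_oo_co.
pose u n := b - (b - a) / n.+1%:R.
have ub n : a <= u n < b.
  rewrite /u gtrBl divr_gt0 ?subr_gt0// andbT lerBrDr addrC -lerBrDr.
  by rewrite ler_pdivrMr// ler_peMr ?subr_ge0 ?ler1n// ltW.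
have inu n x : x \in `[a, u n] -> x \in `[a, b[.
  rewrite !in_itv/= => /andP[-> xu]; rewrite (le_lt_trans xu)//.
  by case/andP: (ub n).
have co_cc x : x \in `[a, b[ -> x \in `[a, b].
  by rewrite !in_itv/= => /andP[-> /ltW].
have ab_a : a \in `[a, b] by rewrite in_itv/= lexx ltW.
have ab_b : b \in `[a, b] by rewrite in_itv/= lexx ltW.
have leF : {in `[a, b] &, {homo F : x y / x <= y}}.
  move=> x y xab yab; rewrite le_eqVlt => /predU1P[->//|xy].
  by rewrite ltW// incF.
have uab n : u n \in `[a, b[ by rewrite in_itv/= ub.
have Fu n : F a <= F (u n) < F b.
  by case/andP: (ub n) => au ltub; rewrite leF ?incF//; exact/co_cc.
have inFu n y : y \in `[F a, F (u n)] -> y \in `[F a, F b[.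
  rewrite !in_itv/= => /andP[-> yu]; rewrite (le_lt_trans yu)//.
  by case/andP: (Fu n).
have ndu : {homo u : n m / (n <= m)%N >-> n <= m}.
  move=> n m nm; rewrite lerB// ler_wpM2l ?subr_ge0 ?(ltW ab)//.
  by rewrite lef_pV2 ?posrE// ler_nat.
have uE : (`[a, b[ = \bigcup_n `[a, u n])%classic.
  apply/seteqP; split => x /=; last first.
    by move=> [n _ /= xu]; exact: (inu n).
  rewrite in_itv/= => /andP[ax xb].
  have [n nE] : exists n, (b - a) / n.+1%:R <= b - x.
    exists (Num.truncn ((b - a) / (b - x))).
    rewrite ler_pdivrMr// mulrC -ler_pdivrMr ?subr_gt0//.
    by rewrite ltW// truncnS_gt.
  by exists n => //=; rewrite in_itv/= ax/= lerBrDl addrC -lerBrDl.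
have FuE : (`[F a, F b[ = \bigcup_n `[F a, F (u n)])%classic.
  apply/seteqP; split => y /=; last first.
    by move=> [n _ /= yu]; exact: (inFu n).
  rewrite in_itv/= => /andP[ay yb].
  have [c cab Fcy] : exists2 c, c \in `[a, b] & F c = y.
    apply: IVT; first exact: ltW.
      by apply: continuous_subspaceT.
    by rewrite ge_min ay/= le_max (ltW yb) orbT.
  have : (`[a, b[)%classic c.
    move: cab; rewrite /= !in_itv/= => /andP[-> ]; rewrite le_eqVlt => /predU1P[cb|//].
    by move: yb; rewrite -Fcy cb ltxx.
  rewrite uE => -[n _ /=]; rewrite in_itv/= => /andP[ac cu].
  exists n => //=; rewrite in_itv/= ay/= -Fcy leF//.
  exact: co_cc.
have FinFu n x : x \in `[a, u n] -> F x \in `[F a, F (u n)].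
  move=> /[dup] xu; rewrite in_itv/= => /andP[ax xun]; rewrite in_itv/=.
  by rewrite !leF//; apply: co_cc => //; exact: (inu n).
have step n : (\int[@lebesgue_measure R]_(x in `[F a, F (u n)]) (f x)%:E =
    \int[@lebesgue_measure R]_(x in `[a, u n]) (f (F x) * F' x)%:E)%E.
  rewrite integration_by_substitution_increasing ?F'E//.
  - by case/andP: (ub n).
  - by move=> x y /inu/co_cc xu /inu/co_cc yu; exact: incF.
  - by apply: (cvgP (F' _)); apply: cvg_at_right_filter; exact: cF'.
  - by apply: (cvgP (F' _)); apply: cvg_at_left_filter; exact: cF'.
  - split; first by move=> x _; case: (dF x).
      by apply: cvg_at_right_filter; exact: cF.
    by apply: cvg_at_left_filter; exact: cF.
  - by apply: continuous_in_subspaceT => y /[!inE] yu; apply: cf; exact: (inFu n).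
have nd1 : nondecreasing_seq (fun n => `[a, u n]%classic).
  move=> n m nm; rewrite subsetEset; apply: subset_itvl.
  by rewrite bnd_simp ndu.
have nd2 : nondecreasing_seq (fun n => `[F a, F (u n)]%classic).
  move=> n m nm; rewrite subsetEset; apply: subset_itvl.
  by rewrite bnd_simp leF ?ndu//; exact: co_cc.
rewrite uE FuE.
have c1 :
  (\int[@lebesgue_measure R]_(x in `[F a, F (u n)]) (f x)%:E @[n --> \oo] -->
    \int[@lebesgue_measure R]_(x in \bigcup_n `[F a, F (u n)]%classic) (f x)%:E)%E.
  apply: ge0_nondecreasing_set_cvg_integral => //.
  - move=> n; apply/measurable_EFinP; apply: subspace_continuous_measurable_fun => //.
    by apply: continuous_in_subspaceT => y /[!inE] yu; apply: cf; exact: (inFu n).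
  - by move=> n y yu; rewrite lee_fin f0//; exact: (inFu n).
have c2 :
  (\int[@lebesgue_measure R]_(x in `[a, u n]) (f (F x) * F' x)%:E @[n --> \oo] -->
   \int[@lebesgue_measure R]_(x in \bigcup_n `[a, u n]%classic)
     (f (F x) * F' x)%:E)%E.
  apply: ge0_nondecreasing_set_cvg_integral => //.
  - move=> n; apply/measurable_EFinP; apply: subspace_continuous_measurable_fun => //.
    apply: continuous_in_subspaceT => x /[!inE] xu; apply: cvgM; last exact: cF'.
    apply: continuous_comp; first exact: cF.
    exact/cf/(inFu n)/FinFu.
  - move=> n x xu; rewrite lee_fin mulr_ge0//.
      exact/f0/(inFu n)/FinFu.
    by rewrite ltW// F'gt0//; exact: (inu n).
move: c1; under eq_fun do rewrite step.
by move=> c1; exact: (cvg_unique _ c1 c2).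
Qed.

(** * Elliptic integrals over a quarter period *)

(** Substitution x = G (sin t).  The last hypothesis says that
    G' s ds / sqrt ((1 - G^2)(1 - k^2 G^2)) = H s ds / sqrt (1 - s^2), and
    ds / sqrt (1 - s^2) = dt absorbs the singularity at x = 1. *)
Lemma ellipticK_subst_sin (R : realType) (k : R) (G G' H : R -> R) :
  k ^+ 2 <= 1 -> G 0 = 0 -> G 1 = 1 ->
  (forall s : R, -1 <= s <= 1 -> is_derive s 1 G (G' s)) ->
  (forall s : R, -1 <= s <= 1 -> {for s, continuous G'}) ->
  (forall s : R, -1 <= s <= 1 -> {for s, continuous H}) ->
  (forall s : R, 0 <= s < 1 -> 0 < G' s) ->
  (forall s : R, 0 <= s < 1 ->
    Num.sqrt ((1 - G s ^+ 2) * (1 - k ^+ 2 * G s ^+ 2)) * H s =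
    G' s * Num.sqrt (1 - s ^+ 2)) ->
  ellipticK k = \int[@lebesgue_measure R]_(t in `[0, pi / 2]) H (sin t).
Proof.
move=> k1 G0 G1 dG cG' cH G'gt0 GH.
have sin_itv (t : R) : -1 <= sin t <= 1 by rewrite sin_geN1 sin_le1.
have pi20 : 0 < pi / 2 :> R by rewrite divr_gt0// pi_gt0.
pose f (x : R) := (Num.sqrt ((1 - x ^+ 2) * (1 - k ^+ 2 * x ^+ 2)))^-1.
pose F := G \o sin.
pose F' (t : R) := G' (sin t) * cos t.
have dF (t : R) : is_derive t 1 F (F' t).
  by apply: is_derive1_comp; exact: dG.
have cF' : continuous F'.
  move=> t; apply: cvgM; last exact: continuous_cos.
  by apply: continuous_comp; [exact: continuous_sin|exact: cG'].
have npi : - (pi / 2) <= 0 :> R by rewrite oppr_le0 ltW.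
have sin01 (t : R) : t \in `[0, pi / 2[ -> 0 <= sin t < 1.
  rewrite in_itv/= => /andP[t0 tpi]; rewrite sin_ge0_pi/=.
    rewrite -sin_pihalf ltr_sin// in_itv/=.
      by rewrite (le_trans npi t0) ltW.
    by rewrite (le_trans npi (ltW pi20)) lexx.
  rewrite t0 (le_trans (ltW tpi))// ler_pdivrMr// ler_pMr ?pi_gt0//.
  by rewrite ler1n.
have cos0 (t : R) : t \in `[0, pi / 2[ -> 0 < cos t.
  rewrite in_itv/= => /andP[t0 tpi]; apply: cos_gt0_pihalf.
  by rewrite tpi andbT (lt_le_trans _ t0)// oppr_lt0.
have cosE (t : R) : t \in `[0, pi / 2[ -> Num.sqrt (1 - sin t ^+ 2) = cos t.
  by move=> tI; rewrite -cos2sin2 sqrtr_sqr gtr0_norm// cos0.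
have F'gt0 : {in `[0, pi / 2[, forall t, 0 < F' t}.
  by move=> t tI; rewrite mulr_gt0 ?cos0// G'gt0// sin01.
have FE : F 0 = 0 /\ F (pi / 2) = 1 by rewrite /F/= sin0 sin_pihalf.
have rad_gt0 (x : R) : x \in `[0, 1[ -> 0 < (1 - x ^+ 2) * (1 - k ^+ 2 * x ^+ 2).
  rewrite in_itv/= => /andP[x0 x1].
  have x21 : x ^+ 2 < 1 by rewrite exprn_ilt1.
  by rewrite mulr_gt0// subr_gt0// (le_lt_trans _ x21)// ler_piMl// sqr_ge0.
have cf : {in `[0, 1[, continuous f}.
  move=> z zI; apply: cvgV; first by rewrite gt_eqF// sqrtr_gt0 rad_gt0.
  apply: continuous_cvg; first exact: sqrt_continuous.
  have cx : y ^+ 2 @[y --> z] --> z ^+ 2 by exact: exprn_continuous.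
  apply: cvgM; apply: cvgB; try exact: cvg_cst; first exact: cx.
  by apply: cvgM; [exact: cvg_cst|exact: cx].
have f0 : {in `[0, 1[, forall x, 0 <= f x}.
  by move=> x _; rewrite invr_ge0 sqrtr_ge0.
have := integral_subst_itvco R F F' f 0 (pi / 2) pi20 dF cF' F'gt0.
rewrite FE.1 FE.2 => /(_ cf f0) substE.
rewrite /ellipticK /Rintegral -/f; congr fine.
have cHsin : continuous (fun t : R => H (sin t)).
  by move=> t; apply: continuous_comp; [exact: continuous_sin|exact: cH].
rewrite -[LHS]integral_itv_bndo_bndc; last first.
  apply/measurable_EFinP; apply: subspace_continuous_measurable_fun => //.
  by apply: continuous_in_subspaceT => x /[!inE] xI; exact: cf.
rewrite -[RHS]integral_itv_bndo_bndc; last first.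
  apply/measurable_EFinP; apply: subspace_continuous_measurable_fun => //.
  exact: continuous_subspaceT.
rewrite [LHS]substE; apply: eq_integral => t /[!inE] tI; congr EFin.
have := GH _ (sin01 _ tI); rewrite cosE//.
have := F'gt0 _ tI; rewrite /F' /f /F/= => F'0 E.
rewrite -E; rewrite -E in F'0.
rewrite mulKf//; apply/eqP => E0; move: F'0.
by rewrite E0 mul0r ltxx.
Qed.

(** * The two moduli lead to the same radical *)

Section two_elliptic_integrals.
Variables (R : realType) (b A B : R).
Implicit Type s : R.
Hypotheses (b1 : 1 < b) (AB : B ^+ 2 + A ^+ 2 = 1).

(** The squared modulus of b^2 - e^(2ia) s^2, when A = sin a and B = cos a. *)
Definition quartic (s : R) : R :=
  b ^+ 4 - 2 * b ^+ 2 * (B ^+ 2 - A ^+ 2) * s ^+ 2 + s ^+ 4.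

Lemma quartic_sin s :
  quartic s = (b ^+ 2 - s ^+ 2) ^+ 2 + (2 * b * A * s) ^+ 2.
Proof.
apply/eqP; rewrite -subr_eq0; apply/eqP.
transitivity (2 * b ^+ 2 * s ^+ 2 * (1 - (B ^+ 2 + A ^+ 2))).
  by rewrite /quartic; ring.
by rewrite AB subrr mulr0.
Qed.

(** This form makes 1 - k^2 x^2 a multiple of the quartic for the modulus
    containing cos a, whereas [quartic_sin] makes it a square for the modulus
    containing sin a. *)
Lemma quartic_cos s :
  quartic s = (b ^+ 2 + s ^+ 2) ^+ 2 - (2 * b * B * s) ^+ 2.
Proof.
apply/eqP; rewrite -subr_eq0; apply/eqP.
transitivity (2 * b ^+ 2 * s ^+ 2 * (B ^+ 2 + A ^+ 2 - 1)).
  by rewrite /quartic; ring.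
by rewrite AB subrr mulr0.
Qed.

Lemma sqr_le1_itv (s : R) : -1 <= s <= 1 -> s ^+ 2 <= 1.
Proof. by move=> /andP[s1 s2]; nra. Qed.

Let b2_gt1 : 1 < b ^+ 2. Proof. by rewrite exprn_egt1. Qed.

Let b_gt0 : 0 < b. Proof. exact: lt_trans ltr01 b1. Qed.

Lemma quartic_gt0 s : -1 <= s <= 1 -> 0 < quartic s.
Proof.
move=> /sqr_le1_itv s1; rewrite quartic_sin ltr_wpDr ?sqr_ge0//.
by rewrite exprn_gt0// subr_gt0 (le_lt_trans s1).
Qed.

Let b4_gt s : -1 <= s <= 1 -> 0 < b ^+ 4 - s ^+ 2.
Proof.
move=> /sqr_le1_itv s1; rewrite subr_gt0 (le_lt_trans s1)//.
by rewrite exprn_egt1.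
Qed.

Let itv01 s : 0 <= s < 1 -> -1 <= s <= 1.
Proof. by move=> /andP[s0 /ltW ->]; rewrite andbT (le_trans _ s0)// oppr_le0. Qed.

Let continuous_sqr (s : R) : (x ^+ 2 @[x --> s] --> s ^+ 2).
Proof. exact: exprn_continuous. Qed.

Lemma continuous_quartic s : {for s, continuous quartic}.
Proof.
apply: cvgD; last exact: exprn_continuous.
by apply: cvgB; [exact: cvg_cst|apply: cvgM; [exact: cvg_cst|exact: continuous_sqr]].
Qed.

Let continuous_sqrt_quartic s : {for s, continuous (fun x => Num.sqrt (quartic x))}.
Proof.
by apply: continuous_cvg; [exact: sqrt_continuous|exact: continuous_quartic].
Qed.

Definition radical (s : R) : R :=
  Num.sqrt (b ^+ 4 - s ^+ 2) * Num.sqrt (quartic s).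

Lemma radical_gt0 s : -1 <= s <= 1 -> 0 < radical s.
Proof. by move=> sI; rewrite mulr_gt0// sqrtr_gt0 ?quartic_gt0 ?b4_gt. Qed.

Lemma continuous_radicalV s : -1 <= s <= 1 ->
  {for s, continuous (fun x => (radical x)^-1)}.
Proof.
move=> sI; apply: cvgV; first by rewrite gt_eqF// radical_gt0.
apply: cvgM; last exact: continuous_sqrt_quartic.
apply: continuous_cvg; first exact: sqrt_continuous.
by apply: cvgB; [exact: cvg_cst|exact: continuous_sqr].
Qed.

Lemma ellipticK_cos :
  ellipticK (2 * b * B / (1 + b ^+ 2)) =
  \int[@lebesgue_measure R]_(t in `[0, pi / 2])
     ((1 + b ^+ 2) * (b ^+ 2 - sin t ^+ 2) / radical (sin t)).
Proof.
have c0 : 0 < 1 + b ^+ 2 by rewrite addr_gt0// exprn_gt0.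
have d0 (s : R) : 0 < b ^+ 2 + s ^+ 2 by rewrite ltr_wpDr ?sqr_ge0// exprn_gt0.
apply: (ellipticK_subst_sin R _
  (fun s => (1 + b ^+ 2) * s / (b ^+ 2 + s ^+ 2))
  (fun s => (1 + b ^+ 2) * (b ^+ 2 - s ^+ 2) / (b ^+ 2 + s ^+ 2) ^+ 2)
  (fun s => (1 + b ^+ 2) * (b ^+ 2 - s ^+ 2) / radical s)).
- rewrite expr_div_n ler_pdivrMr ?exprn_gt0// mul1r.
  have := quartic_cos 1; have := @quartic_gt0 1.
  rewrite lexx lerNl (le_trans (lerN10 R) ler01) => /(_ isT) q0 q1.
  move: q0; rewrite q1 expr1n mulr1 subr_gt0 [1 + _]addrC; exact: ltW.
- by rewrite mulr0 mul0r.
- by rewrite mulr1 expr1n [b ^+ 2 + 1]addrC divff// gt_eqF.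
- move=> s _.
  have D : is_derive s 1 (cst (b ^+ 2) + id ^+ 2) (2 * s).
    by apply: is_derive_eq; rewrite /GRing.scale/=; ring.
  have DV := @is_deriveV R (cst (b ^+ 2) + id ^+ 2) s (2 * s) 1 _ D.
  have {}DV := DV (lt0r_neq0 (d0 s)).
  have D2 : is_derive s 1 (cst (1 + b ^+ 2) * id) (1 + b ^+ 2).
    by apply: is_derive_eq; rewrite /GRing.scale/= /cst; ring.
  have := @is_deriveM R R _ _ s 1 _ _ D2 DV.
  set df := (X in is_derive _ _ _ X -> _).
  have -> : df = (1 + b ^+ 2) * (b ^+ 2 - s ^+ 2) / (b ^+ 2 + s ^+ 2) ^+ 2.
    rewrite /df /GRing.scale/= !fctE /cst; field.
    by rewrite gt_eqF.
  by [].
- move=> s _; apply: cvgM.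
    apply: cvgM; [exact: cvg_cst|apply: cvgB; [exact: cvg_cst|exact: continuous_sqr]].
  apply: cvgV; first by rewrite gt_eqF// exprn_gt0.
  have cd : (b ^+ 2 + x ^+ 2 @[x --> s] --> b ^+ 2 + s ^+ 2).
    by apply: cvgD; [exact: cvg_cst|exact: continuous_sqr].
  exact: (cvgM cd cd).
- move=> s sI; apply: cvgM; last exact: continuous_radicalV.
  by apply: cvgM; [exact: cvg_cst|apply: cvgB; [exact: cvg_cst|exact: continuous_sqr]].
- move=> s /itv01/sqr_le1_itv s1; rewrite divr_gt0 ?exprn_gt0// mulr_gt0//.
  by rewrite subr_gt0 (le_lt_trans s1).
- move=> s /[dup] s01 /itv01 sI.
  have s1 := sqr_le1_itv _ sI.
  have e4 := b4_gt _ sI; have q0 := quartic_gt0 _ sI.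
  have s20 : 0 < 1 - s ^+ 2.
    by case/andP: s01 => s_ge0 s_lt1; rewrite subr_gt0 exprn_ilt1.
  have bs : 0 < b ^+ 2 - s ^+ 2 by rewrite subr_gt0 (le_lt_trans s1).
  set X := (X in Num.sqrt X * _ = _).
  have XE : X = (Num.sqrt (1 - s ^+ 2) * radical s / (b ^+ 2 + s ^+ 2) ^+ 2) ^+ 2.
    rewrite expr_div_n !exprMn !sqr_sqrtr ?ltW//.
    rewrite quartic_cos /X.
    by field; rewrite !gt_eqF.
  rewrite XE sqrtr_sqr ger0_norm; last first.
    rewrite divr_ge0 ?exprn_ge0 ?(ltW (d0 _))//.
    by rewrite mulr_ge0 ?sqrtr_ge0 ?ltW ?radical_gt0.
  by field; rewrite !gt_eqF// radical_gt0.
Qed.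

Lemma ellipticK_sin :
  ellipticK (2 * b * A / Num.sqrt (quartic 1)) =
  \int[@lebesgue_measure R]_(t in `[0, pi / 2])
     (Num.sqrt (quartic 1) * (b ^+ 2 + sin t ^+ 2) / radical (sin t)).
Proof.
have I1 : -1 <= (1 : R) <= 1 by rewrite lexx andbT (le_trans (lerN10 R) ler01).
set S := Num.sqrt (quartic 1).
have S0 : 0 < S by rewrite sqrtr_gt0 quartic_gt0.
have d0 (s : R) : 0 < b ^+ 2 + s ^+ 2 by rewrite ltr_wpDr ?sqr_ge0// exprn_gt0.
have bs s : -1 <= s <= 1 -> 0 < b ^+ 2 - s ^+ 2.
  by move=> /sqr_le1_itv s1; rewrite subr_gt0 (le_lt_trans s1).
apply: (ellipticK_subst_sin R _
  (fun s => S * s / Num.sqrt (quartic s))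
  (fun s => S * (b ^+ 4 - s ^+ 4) / (quartic s * Num.sqrt (quartic s)))
  (fun s => S * (b ^+ 2 + s ^+ 2) / radical s)).
- rewrite expr_div_n ler_pdivrMr ?exprn_gt0// mul1r.
  rewrite sqr_sqrtr; last exact/ltW/quartic_gt0.
  by rewrite quartic_sin mulr1 lerDr sqr_ge0.
- by rewrite mulr0 mul0r.
- by rewrite mulr1 divff// gt_eqF.
- move=> s sI.
  have q0 := quartic_gt0 _ sI.
  have sq0 : 0 < Num.sqrt (quartic s) by rewrite sqrtr_gt0.
  have D : is_derive s 1
     (cst (b ^+ 4) - cst (2 * b ^+ 2 * (B ^+ 2 - A ^+ 2)) * id ^+ 2 + id ^+ 4)
     (- (4 * b ^+ 2 * (B ^+ 2 - A ^+ 2) * s) + 4 * s ^+ 3).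
    by apply: is_derive_eq; rewrite /GRing.scale/= !fctE /cst; ring.
  have DS := @is_derive1_comp R Num.sqrt quartic s _ _ (is_derive1_sqrt q0) D.
  have DV := @is_deriveV R (Num.sqrt \o quartic) s _ 1 (lt0r_neq0 sq0) DS.
  have D2 : is_derive s 1 (cst S * id) S.
    by apply: is_derive_eq; rewrite /GRing.scale/= /cst; ring.
  have := @is_deriveM R R _ _ s 1 _ _ D2 DV.
  set df := (X in is_derive _ _ _ X -> _).
  have -> : df = S * (b ^+ 4 - s ^+ 4) / (quartic s * Num.sqrt (quartic s)).
    rewrite /df /GRing.scale/= !fctE /cst/=.
    have qq : quartic s = Num.sqrt (quartic s) ^+ 2 by rewrite sqr_sqrtr// ltW.
    have -> : S * (b ^+ 4 - s ^+ 4) =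
       S * quartic s -
       S * s / 2 * (- (4 * b ^+ 2 * (B ^+ 2 - A ^+ 2) * s) + 4 * s ^+ 3).
      by rewrite /quartic; field.
    rewrite qq sqrtr_sqr (gtr0_norm sq0).
    move: (Num.sqrt (quartic s)) sq0 => q sq0.
    by field; rewrite gt_eqF.
  by [].
- move=> s sI; apply: cvgM.
    apply: cvgM; [exact: cvg_cst|apply: cvgB; [exact: cvg_cst|exact: exprn_continuous]].
  apply: cvgV; first by rewrite gt_eqF// mulr_gt0 ?sqrtr_gt0 ?quartic_gt0.
  by apply: cvgM; [exact: continuous_quartic|exact: continuous_sqrt_quartic].
- move=> s sI; apply: cvgM; last exact: continuous_radicalV.
  by apply: cvgM; [exact: cvg_cst|apply: cvgD; [exact: cvg_cst|exact: continuous_sqr]].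
- move=> s /itv01 sI; rewrite divr_gt0 ?mulr_gt0 ?sqrtr_gt0 ?quartic_gt0//.
  have -> : b ^+ 4 - s ^+ 4 = (b ^+ 2 - s ^+ 2) * (b ^+ 2 + s ^+ 2) by ring.
  by rewrite mulr_gt0 ?bs.
- move=> s /[dup] s01 /itv01 sI.
  have s1 := sqr_le1_itv _ sI.
  have e4 := b4_gt _ sI; have q0 := quartic_gt0 _ sI.
  have s20 : 0 < 1 - s ^+ 2.
    by case/andP: s01 => s_ge0 s_lt1; rewrite subr_gt0 exprn_ilt1.
  have bs0 := bs _ sI.
  have sq0 : 0 < Num.sqrt (quartic s) by rewrite sqrtr_gt0.
  have r0 : 0 < Num.sqrt (b ^+ 4 - s ^+ 2) by rewrite sqrtr_gt0.
  have qq : quartic s = Num.sqrt (quartic s) ^+ 2 by rewrite sqr_sqrtr// ltW.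
  have SS : S ^+ 2 = quartic 1 by rewrite sqr_sqrtr// ltW// quartic_gt0.
  set X := (X in Num.sqrt X * _ = _).
  have XE : X = (Num.sqrt (1 - s ^+ 2) * Num.sqrt (b ^+ 4 - s ^+ 2) *
       (b ^+ 2 - s ^+ 2) / quartic s) ^+ 2.
    rewrite expr_div_n !exprMn !sqr_sqrtr ?ltW//.
    have -> : X = (1 - quartic 1 * s ^+ 2 / quartic s) *
                  (1 - (2 * b * A * s) ^+ 2 / quartic s).
      rewrite /X !expr_div_n !exprMn SS sqr_sqrtr ?ltW//.
      by field; rewrite !gt_eqF// quartic_gt0.
    have -> : 1 - (2 * b * A * s) ^+ 2 / quartic s = (b ^+ 2 - s ^+ 2) ^+ 2 / quartic s.
      apply: (canRL (mulfK (lt0r_neq0 q0))).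
      rewrite mulrBl divfK ?gt_eqF// mul1r quartic_sin; ring.
    have -> : 1 - quartic 1 * s ^+ 2 / quartic s =
       (1 - s ^+ 2) * (b ^+ 4 - s ^+ 2) / quartic s.
      apply: (canRL (mulfK (lt0r_neq0 q0))).
      rewrite mulrBl divfK ?gt_eqF// mul1r /quartic; ring.
    by field; rewrite !gt_eqF.
  rewrite XE sqrtr_sqr ger0_norm; last first.
    by rewrite divr_ge0 ?(ltW q0)// mulr_ge0 ?(ltW bs0)// mulr_ge0 ?sqrtr_ge0.
  rewrite /radical qq sqrtr_sqr (gtr0_norm sq0).
  move: (Num.sqrt (quartic s)) (Num.sqrt (b ^+ 4 - s ^+ 2)) sq0 r0 => q r sq0 r0.
  by field; rewrite !gt_eqF.
Qed.

End two_elliptic_integrals.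

(** * Comparison *)

Lemma lauricella3_density_radical (R : realType) (b A B s : R) :
  1 < b -> B ^+ 2 + A ^+ 2 = 1 -> -1 <= s <= 1 ->
  lauricella3_density R (b ^- 2) (B ^+ 2 - A ^+ 2) (s ^+ 2) =
  b ^+ 4 / radical R b A B s.
Proof.
move=> b1 AB sI; have b0 : 0 < b := lt_trans ltr01 b1.
have s1 := sqr_le1_itv R s sI.
have q0 := ltW (quartic_gt0 R b A B b1 AB s sI).
have e0 : 0 <= b ^+ 4 - s ^+ 2 by rewrite subr_ge0 (le_trans s1)// exprn_ege1// ltW.
have rb0 : 0 <= b ^- 2 by rewrite invr_ge0 exprn_ge0// ltW.
have bn0 : b != 0 by rewrite gt_eqF.
rewrite /lauricella3_density /radical.
have -> : 1 - b ^- 2 ^+ 2 * s ^+ 2 = (b ^+ 4 - s ^+ 2) * (b ^- 2) ^+ 2 by field.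
have -> : 1 - 2 * b ^- 2 * (B ^+ 2 - A ^+ 2) * s ^+ 2 + b ^- 2 ^+ 2 * s ^+ 2 ^+ 2 =
  quartic R b A B s * (b ^- 2) ^+ 2 by rewrite /quartic; field.
rewrite (sqrtrM _ e0) (sqrtrM _ q0) !sqrtr_sqr !(ger0_norm rb0).
have := radical_gt0 R b A B b1 AB s sI; rewrite /radical.
move: (Num.sqrt (b ^+ 4 - s ^+ 2)) (Num.sqrt (quartic R b A B s)) => u v uv0.
have /norP[u0 v0] : ~~ ((u == 0) || (v == 0)) by rewrite -mulf_eq0 gt_eqF.
by field; rewrite u0 v0 bn0.
Qed.

(** (b^2 + s^2) - (b^2 - s^2) = 2 s^2, and s^2 times b^4 over the radical is the
    integrand of the mean of [lauricella3_density]. *)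
Lemma ellipticK_diff (R : realType) (b A B : R) :
  1 < b -> B ^+ 2 + A ^+ 2 = 1 ->
  (1 + b ^+ 2) * ellipticK (2 * b * A / Num.sqrt (quartic R b A B 1))
  - Num.sqrt (quartic R b A B 1) * ellipticK (2 * b * B / (1 + b ^+ 2)) =
  (1 + b ^+ 2) * Num.sqrt (quartic R b A B 1) * (pi / (2 * b ^+ 4)) *
  beta_mean R (lauricella3_density R (b ^- 2) (B ^+ 2 - A ^+ 2)).
Proof.
move=> b1 AB; have b0 : 0 < b := lt_trans ltr01 b1.
have sin_itv (t : R) : -1 <= sin t <= 1 by rewrite sin_geN1 sin_le1.
set S := Num.sqrt (quartic R b A B 1).
have cV : continuous (fun t : R => (radical R b A B (sin t))^-1).
  move=> t; apply: (@continuous_comp _ _ _ sin (fun x => (radical R b A B x)^-1)).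
    exact: continuous_sin.
  exact: continuous_radicalV.
have cs2 : continuous (fun t : R => sin t ^+ 2).
  by move=> t; apply: cvgM; exact: continuous_sin.
pose w (t : R) := radical R b A B (sin t).
pose P := lauricella3_density R (b ^- 2) (B ^+ 2 - A ^+ 2).
have i1 : continuous (fun t : R => S * (b ^+ 2 + sin t ^+ 2) / w t).
  move=> t; apply: cvgM; last exact: cV.
  by apply: cvgM; [exact: cvg_cst|apply: cvgD; [exact: cvg_cst|exact: cs2]].
have i2 : continuous (fun t : R => (1 + b ^+ 2) * (b ^+ 2 - sin t ^+ 2) / w t).
  move=> t; apply: cvgM; last exact: cV.
  by apply: cvgM; [exact: cvg_cst|apply: cvgB; [exact: cvg_cst|exact: cs2]].
have i3 : continuous (fun t : R => sin t ^+ 2 * P (sin t ^+ 2)).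
  have -> : (fun t : R => sin t ^+ 2 * P (sin t ^+ 2)) =
      (fun t : R => sin t ^+ 2 * (b ^+ 4 / w t)).
    by apply/funext => t; rewrite /P lauricella3_density_radical.
  move=> t; apply: cvgM; first exact: cs2.
  by apply: cvgM; [exact: cvg_cst|exact: cV].
rewrite (ellipticK_sin R b A B)// (ellipticK_cos R b A B)// -/S.
have cZ (k : R) (f : R -> R) : continuous f -> continuous (fun t => k * f t).
  by move=> cf t; apply: cvgM; [exact: cvg_cst|exact: cf].
rewrite /beta_mean [RHS]mulrA -!RintegralZl//; try exact: integrable_quarter_period.
rewrite -RintegralB//; try exact/integrable_quarter_period/cZ.
apply: eq_Rintegral => t _; rewrite lauricella3_density_radical//.
have := radical_gt0 R b A B b1 AB _ (sin_itv t).
rewrite -/(w t); move: (w t) => v v0.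
have pi0 : pi != 0 :> R by rewrite gt_eqF// pi_gt0.
move: (@pi R) pi0 => p p0; field.
by rewrite p0 !gt_eqF.
Qed.

Theorem theorem4p7 (R : realType) (a b : R) (hb : 1 < b) :
  (pi : R)%:C =
    (2 * b ^+ 4 *
      ((1 + b ^+ 2) *
         ellipticK (2 * b * sin a
                    / Num.sqrt (b ^+ 4 - 2 * b ^+ 2 * cos (2 * a) + 1))
       - Num.sqrt (b ^+ 4 - 2 * b ^+ 2 * cos (2 * a) + 1) *
         ellipticK (2 * b * cos a / (1 + b ^+ 2))))%:C
    / (((1 + b ^+ 2)
          * Num.sqrt (b ^+ 4 - 2 * b ^+ 2 * cos (2 * a) + 1))%:C
       * lauricellaFD (3 / 2) [tuple 1 / 2; 1 / 2; 1 / 2] 2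
           [tuple 1 / b%:C ^+ 4;
                  cexp ((- (2 * a))*i) / b%:C ^+ 2;
                  cexp ((2 * a)*i) / b%:C ^+ 2]).
Proof.
have b0 : 0 < b := lt_trans ltr01 hb.
have c2E : cos (2 * a) = cos a ^+ 2 - sin a ^+ 2.
  by rewrite mulr_natl mulr2n cosD !expr2.
have r01 : 0 <= b ^- 2 < 1.
  by rewrite invr_ge0 exprn_ge0 ?(ltW b0)//= invf_lt1 ?exprn_gt0// exprn_egt1.
have -> : b ^+ 4 - 2 * b ^+ 2 * cos (2 * a) + 1 = quartic R b (sin a) (cos a) 1.
  by rewrite /quartic c2E !expr1n mulr1.
have b2C : b%:C ^+ 2 = (b ^+ 2)%:C by rewrite rmorphXn.
have x1 : 1 / b%:C ^+ 4 = (b ^- 2 ^+ 2)%:C.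
  by rewrite div1r exprVn rmorphV/= -?exprM ?rmorphXn// unitfE expf_neq0// gt_eqF.
have x2 : cexp ((- (2 * a))*i) / b%:C ^+ 2 =
    (b ^- 2)%:C * (cos (2 * a) -i* sin (2 * a)).
  by rewrite /cexp/= expR0 cosN sinN rmorph1 mul1r b2C -fmorphV mulrC.
have x3 : cexp ((2 * a)*i) / b%:C ^+ 2 =
    (b ^- 2)%:C * (cos (2 * a) +i* sin (2 * a)).
  by rewrite /cexp/= expR0 rmorph1 mul1r b2C -fmorphV mulrC.
rewrite x1 x2 x3 lauricella3_beta_mean//; last exact: cos2Dsin2.
rewrite ellipticK_diff//; last exact: cos2Dsin2.
rewrite -c2E.
rewrite -rmorphM -fmorphV -rmorphM; congr (_%:C).
have : 0 < beta_mean R (lauricella3_density R (b ^- 2) (cos (2 * a))).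
  by rewrite beta_mean_lauricella3_density_gt0// cos_geN1 cos_le1.
move: (beta_mean _ _) => F F0.
have S0 : 0 < Num.sqrt (quartic R b (sin a) (cos a) 1).
  rewrite sqrtr_gt0 quartic_gt0//; first exact: cos2Dsin2.
  by rewrite lexx andbT (le_trans (lerN10 R) ler01).
move: (Num.sqrt _) S0 => S S0.
have c0 : 0 < 1 + b ^+ 2 by rewrite addr_gt0// exprn_gt0.
move: (@pi R) => p.
by field; rewrite !gt_eqF.
Qed.
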